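(* Every $P_4$-free graph is CDC.
   Context: All graphs are finite, simple, undirected, with nonempty vertex set. A graph is $P_4$-free if it has no induced subgraph isomorphic to the path on $4$ vertices. A clique is a set of pairwise adjacent vertices; it is maximal if it is not contained in a larger clique. A clique transversal of a graph is a set of vertices containing at least one vertex from each maximal clique; it is minimal if it contains no smaller clique transversal. A hypergraph is a pair $(V,E)$ with $V$ a finite set and $E$ a set of subsets of $V$ (hyperedges) such that every vertex belongs to a hyperedge; it is conformal if every set of vertices such that any two of them belong to a common hyperedge is itself contained in a hyperedge. A graph $G$ is clique dually conformal (CDC) if the hypergraph with vertex set $V(G)$ whose hyperedges are the minimal clique transversals of $G$ is conformal. *)

(* Defs.v *)
From mathcomp Require Import all_boot.

Set Implicit Arguments.
Unset Strict Implicit.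
Unset Printing Implicit Defensive.

Record sgraph := SGraph {
  vertex :> finType;
  adj : rel vertex;
  adj_sym : symmetric adj;
  adj_irrefl : irreflexive adj }.

Section Induced.
Variables (G : sgraph) (S : {set G}).

Definition induced_adj : rel {x : G | x \in S} :=
  fun x y => adj (val x) (val y).

Lemma induced_adj_sym : symmetric induced_adj.
Proof. by move=> x y; apply: adj_sym. Qed.

Lemma induced_adj_irrefl : irreflexive induced_adj.
Proof. by move=> x; apply: adj_irrefl. Qed.

Definition induced : sgraph := SGraph induced_adj_sym induced_adj_irrefl.

End Induced.

Definition isomorphic (G H : sgraph) : Prop :=
  exists f : G -> H, bijective f /\ forall x y, adj (f x) (f y) = adj x y.

Definition path_adj (n : nat) : rel 'I_n :=
  fun i j => (i.+1 == j :> nat) || (j.+1 == i :> nat).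

Lemma path_adj_sym n : symmetric (@path_adj n).
Proof. by move=> i j; rewrite /path_adj orbC. Qed.

Lemma path_adj_irrefl n : irreflexive (@path_adj n).
Proof. by move=> i; rewrite /path_adj orbb eqn_leq ltnn. Qed.

(* The path with n vertices (not n edges). *)
Definition path_graph (n : nat) : sgraph :=
  SGraph (@path_adj_sym n) (@path_adj_irrefl n).

Definition P4_free (G : sgraph) : Prop :=
  ~ exists S : {set G}, isomorphic (induced S) (path_graph 4).

Section Cliques.
Variable G : sgraph.

Definition clique (K : {set G}) : bool :=
  [forall x in K, forall y in K, (x != y) ==> adj x y].

Definition maximal_clique (K : {set G}) : bool := maxset clique K.

Definition clique_transversal (X : {set G}) : bool :=
  [forall K : {set G}, maximal_clique K ==> (X :&: K != set0)].

Definition minimal_clique_transversal (X : {set G}) : bool :=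
  minset clique_transversal X.

End Cliques.

Record hypergraph (V : finType) := Hypergraph {
  hyperedges : {set {set V}};
  hyperedges_cover : forall v : V, exists2 X, X \in hyperedges & v \in X }.

(* "Any two" is read as "any two distinct"; since every vertex belongs to a
   hyperedge, allowing x = y gives the same notion. *)
Definition conformal (V : finType) (H : hypergraph V) : Prop :=
  forall S : {set V},
    (forall x y, x \in S -> y \in S -> x != y ->
       exists2 X, X \in hyperedges H & (x \in X) && (y \in X)) ->
    exists2 X, X \in hyperedges H & S \subset X.

Section CDC.
Variable G : sgraph.

Lemma minimal_clique_transversal_cover (v : G) :
  exists2 X, X \in [set X : {set G} | minimal_clique_transversal X] & v \in X.
Proof.
have clv : clique [set v].
  apply/forall_inP=> x /set1P ->; apply/forall_inP=> y /set1P ->.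
  by rewrite eqxx.
have [K maxK /subsetP vK] := maxset_exists clv.
have {}vK : v \in K by apply: vK; rewrite set11.
have trX : clique_transversal (v |: ~: K).
  apply/forall_inP=> L maxL; apply/set0Pn.
  have [sLK | /subsetPn[w Lw notKw]] := boolP (L \subset K).
    have [_ /(_ _ (maxsetp maxK) sLK) defK] := maxsetP maxL.
    by exists v; rewrite !inE eqxx -defK.
  by exists w; rewrite !inE notKw orbT.
have [X minX sX] := minset_exists trX.
exists X; first by rewrite inE.
have /forall_inP/(_ K maxK)/set0Pn[w /setIP[Xw Kw]] := minsetp minX.
by have := subsetP sX w Xw; rewrite !inE Kw orbF => /eqP <-.
Qed.

Definition minimal_clique_transversal_hypergraph : hypergraph G :=
  Hypergraph minimal_clique_transversal_cover.

Definition CDC : Prop := conformal minimal_clique_transversal_hypergraph.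

End CDC.

(* Main.v *)
Require Import Defs.
From mathcomp Require Import all_boot.

(** In a [P_4]-free graph the minimal clique transversals are exactly the
    maximal stable sets, and maximal stable sets always form a conformal
    hypergraph: a set whose vertices pairwise lie in a common stable set is
    itself stable, hence extends to a maximal stable set.

    The identification of the two families rests on two facts about a
    [P_4]-free graph.
    - A maximal stable set meets every maximal clique
      ([stable_clique_crossing]).  So maximal stable sets are clique
      transversals, and they are minimal since a clique meets a stable set in
      at most one vertex.
    - If the vertices are split into [X] and [Y], then [X] contains a maximal
      stable set or [Y] contains a maximal clique
      ([stable_or_clique_in_bipartition]).  When [X] is a clique transversal
      the second case is impossible, so a minimal transversal [X] equals a
      stable set that it contains.

    The second fact is proved by induction on the number of vertices, deleting
    one vertex at a time.  In a minimal counterexample each vertex [v] of [Y]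
    comes with a stable set in [X] that only [v] extends, and each [x] in [X]
    with a clique in [Y] that only [x] extends.  The first fact forces these
    sets to be the non-neighbourhood of [v] in [X] and the neighbourhood of
    [x] in [Y]; that rigid structure is then easily contradicted.  Working
    with subsets [W] of the vertices of a fixed graph replaces induced
    subgraphs throughout. *)

Set Implicit Arguments.
Unset Strict Implicit.
Unset Printing Implicit Defensive.

(** * Four vertices inducing a path *)

(** The forbidden path in the form in which it is used: three edges and two
    non-edges force the last edge.  The four vertices of a violation are
    automatically distinct, because no two vertices of [P_4] have the same
    neighbourhood. *)
Lemma P4_free_pattern (G : sgraph) (a b c d : G) : P4_free G ->
  adj a b -> adj b c -> adj c d -> ~~ adj a c -> ~~ adj b d -> adj a d.
Proof.
move=> freeG ab bc cd nac nbd; apply: contraT => nad; case: freeG.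
have ba : adj b a by rewrite adj_sym.
have cb : adj c b by rewrite adj_sym.
have dc : adj d c by rewrite adj_sym.
have nca : ~~ adj c a by rewrite adj_sym.
have ndb : ~~ adj d b by rewrite adj_sym.
have nda : ~~ adj d a by rewrite adj_sym.
pose s := [:: a; b; c; d].
have neq (x y z : G) : adj x z -> ~~ adj y z -> x != y.
  by move=> xz; apply: contraNneq => <-.
have Us : uniq s.
  have ca : c != a by apply: (neq c a d).
  rewrite /= !inE !negb_or (eq_sym a c) ca (neq a b b) ?(neq a d b) //;
  by rewrite ?(neq b c c) ?(neq b d a) ?(neq c d d) ?adj_irrefl.
have adj_s (i j : 'I_4) : adj (nth a s i) (nth a s j) = path_adj i j.
  rewrite /path_adj; case: i => [[|[|[|[|//]]]] ?];
  case: j => [[|[|[|[|//]]]] ?]; rewrite /= ?adj_irrefl //;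
  exact: negbTE.
exists [set x in s].
pose f (x : induced [set x in s]) : path_graph 4 := inord (index (val x) s).
have s_f x : nth a s (f x) = val x.
  have xs : val x \in s by have := valP x; rewrite inE.
  by rewrite inordK ?nth_index // -[4]/(size s) index_mem.
have mem_s (i : 'I_4) : nth a s i \in [set x in s].
  by rewrite inE mem_nth.
exists f; split; last by move=> x y; rewrite /= -adj_s !s_f.
exists (fun i : 'I_4 => exist _ (nth a s i) (mem_s i)) => [x|i].
  by apply: val_inj; rewrite /= s_f.
by apply: val_inj; rewrite /= inordK index_uniq.
Qed.

(** * Maximal cliques and stable sets relative to a set of vertices *)

Section Homogeneous.
Variable T : finType.
Implicit Types (e : rel T) (K W : {set T}).

(** With [e] the adjacency these are the cliques, with [e] the non-adjacency
    the stable sets; one definition serves both sides of the duality. *)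
Definition homogeneous e K : bool :=
  [forall x in K, forall y in K, (x != y) ==> e x y].

(** Only the vertices of [W] are tested against [K], and [K] may leave [W]:
    this way a vertex of [K] can be deleted from [W] or put back freely. *)
Definition maximal_in e W K : bool :=
  homogeneous e K && [forall w in W, (w \notin K) ==> [exists k in K, ~~ e w k]].

Lemma homogeneousP e K :
  reflect (forall x y, x \in K -> y \in K -> x != y -> e x y)
          (homogeneous e K).
Proof.
apply: (iffP forall_inP) => [H x y Kx Ky | H x Kx].
  by move/forall_inP: (H x Kx) => /(_ y Ky)/implyP.
by apply/forall_inP => y Ky; apply/implyP; apply: H.
Qed.

Lemma maximal_inP e W K :
  reflect (homogeneous e K /\
           forall w, w \in W -> w \notin K -> exists2 k, k \in K & ~~ e w k)
          (maximal_in e W K).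
Proof.
apply: (iffP andP) => -[hK H]; split=> //.
  move=> w Ww nKw; move/forall_inP: H => /(_ w Ww)/implyP/(_ nKw).
  by move/exists_inP.
by apply/forall_inP => w Ww; apply/implyP => nKw; apply/exists_inP; apply: H.
Qed.

Lemma homogeneousU1 e v K : symmetric e -> homogeneous e K ->
  (forall k, k \in K -> e v k) -> homogeneous e (v |: K).
Proof.
move=> sym_e /homogeneousP hK vK; apply/homogeneousP => x y.
case/setU1P=> [->|Kx] /setU1P[->|Ky] xy; first by rewrite eqxx in xy.
- exact: vK.
- by rewrite sym_e vK.
- exact: hK.
Qed.

Lemma maxset_homogeneousE e K : symmetric e ->
  maxset (homogeneous e) K = maximal_in e setT K.
Proof.
move=> sym_e; apply/maxsetP/maximal_inP => -[hK H]; split=> //.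
  move=> w _ nKw; apply/exists_inP; apply: contraR nKw.
  rewrite negb_exists_in => /forall_inP eK.
  have <- := H (w |: K); rewrite ?setU11 ?subsetU1 //.
  by apply: homogeneousU1 => // k /eK; rewrite negbK.
move=> L /homogeneousP hL sKL; apply/eqP; rewrite eqEsubset sKL andbT.
apply/subsetP => w Lw; apply: contraT => nKw.
have [k Kk /negP[]] := H w (in_setT w) nKw.
by apply: hL (subsetP sKL k Kk) _ => //; apply: contraNneq nKw => ->.
Qed.

(** Putting a deleted vertex back either preserves maximality, or the vertex
    extends the set, which then becomes maximal again. *)
Lemma maximal_in_undelete e W v K : symmetric e -> maximal_in e (W :\ v) K ->
  maximal_in e W K \/
  (forall k, k \in K -> e v k) /\ maximal_in e W (v |: K).
Proof.
move=> sym_e /maximal_inP[hK maxK].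
have [/exists_inP[k0 Kk0 vk0] | ] := boolP [exists k in K, ~~ e v k].
  left; apply/maximal_inP; split=> // w Ww nKw.
  by have [-> | wv] := eqVneq w v; [exists k0 | apply: maxK; rewrite // !inE wv].
rewrite negb_exists_in => /forall_inP vK; right.
have {}vK k : k \in K -> e v k by move/vK; rewrite negbK.
split=> //; apply/maximal_inP; split; first exact: homogeneousU1.
move=> w Ww; rewrite !inE negb_or => /andP[wv nKw].
have [|k Kk wk] := maxK w _ nKw; first by rewrite !inE wv.
by exists k; rewrite // !inE Kk orbT.
Qed.

End Homogeneous.

Section P4FreeGraph.
Variable G : sgraph.
Hypothesis freeG : P4_free G.
Implicit Types (K S X Y W : {set G}) (v w x y : G).

Definition nonadj : rel G := fun x y => ~~ adj x y.

Lemma nonadj_sym : symmetric nonadj.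
Proof. by move=> x y; rewrite /nonadj adj_sym. Qed.

Lemma stable_nonadj S x y :
  homogeneous nonadj S -> x \in S -> y \in S -> ~~ adj x y.
Proof.
move=> /homogeneousP hS Sx Sy.
by have [->|xy] := eqVneq x y; [rewrite adj_irrefl | apply: hS].
Qed.

(** * Maximal stable sets meet maximal cliques *)

(** Take [s] in [S] with the most neighbours in [K], a non-neighbour [v] of
    [s] in [K], and a neighbour [t] of [v] in [S].  By the choice of [s], some
    [u] in [K] is adjacent to [s] but not to [t], and [s u v t] is an induced
    path. *)
Lemma stable_clique_crossing S K :
    homogeneous nonadj S -> homogeneous (@adj G) K ->
    (forall k, k \in K -> exists2 s, s \in S & adj k s) ->
    (forall s, s \in S -> exists2 k, k \in K & ~~ adj s k) ->
  S = set0.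
Proof.
move=> hS /homogeneousP hK KS SK; apply/eqP; apply: contraT => /set0Pn[s0 Ss0].
pose N s := [set k in K | adj s k].
case: (arg_maxnP (fun s => #|N s|) Ss0) => s Ss maxs.
have [v Kv nsv] := SK s Ss; have [t St vt] := KS v Kv.
have /subsetPn[u] : ~~ (N s \subset N t).
  apply/negP => sub; have := maxs t St; rewrite /= leqNgt => /negP[].
  apply: proper_card; apply/properP; split=> //.
  by exists v; rewrite !inE Kv /= ?(negPf nsv) // adj_sym.
rewrite !inE => /andP[Ku su]; rewrite Ku /= => ntu.
have uv : adj u v by apply: hK => //; apply: contraNneq nsv => <-.
have: adj s t by apply: P4_free_pattern su uv vt nsv _; rewrite // adj_sym.
by rewrite (negPf (stable_nonadj hS Ss St)).
Qed.

Lemma maximal_stable_meets_clique S K :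
  maximal_in nonadj setT S -> maximal_in (@adj G) setT K -> 0 < #|G| ->
  exists2 x, x \in S & x \in K.
Proof.
move=> /maximal_inP[hS maxS] /maximal_inP[hK maxK] /card_gt0P[g _].
apply/exists_inP; apply: contraT; rewrite negb_exists_in => /forall_inP SK.
have S0 : S = set0.
  apply: (stable_clique_crossing hS hK) => [k Kk | s Ss]; last first.
    exact: maxK (in_setT s) (SK s Ss).
  have [|s Ss ks] := maxS k (in_setT k); first exact: contraL (SK k) Kk.
  by exists s; rewrite // -[adj _ _]negbK.
by have [|s] := maxS g (in_setT g); rewrite S0 inE.
Qed.

(** * A maximal stable set or a maximal clique in a bipartition *)

(** The hypotheses describe a vertex-minimal counterexample [W] to
    [stable_or_clique_in_bipartition]: [S] is a stable set in [X] that only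
    [v] extends and [K] is a clique in [Y] that only [x] extends.  If both
    [x \notin S] and [v \notin K], then [v] and [x] play no part in the
    maximality of [S] against [K] and of [K] against [S], which
    [stable_clique_crossing] excludes.  Since [v] is non-adjacent to [S] and
    [x] is adjacent to [K], the adjacency of [x] and [v] decides which of the
    two memberships holds. *)
Lemma critical_pair W X Y v x S K : [disjoint X & Y] ->
    X \subset W -> Y \subset W -> v \in Y -> x \in X ->
    S \subset X -> maximal_in nonadj (W :\ v) S ->
    (forall s, s \in S -> nonadj v s) ->
    K \subset Y -> maximal_in (@adj G) (W :\ x) K ->
    (forall k, k \in K -> adj x k) ->
  (adj x v -> v \in K) /\ (nonadj x v -> x \in S).
Proof.
move=> dXY sXW sYW Yv Xx sSX /maximal_inP[hS maxS] vS.
move=> sKY /maximal_inP[hK maxK] xK.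
have XnY z : z \in X -> z \notin Y by move=> Xz; rewrite (disjointFr dXY Xz).
have vx : v != x by apply: contraTneq Yv => ->; apply: XnY.
have cross : v \notin K -> x \notin S -> S = set0.
  move=> nKv nSx; apply: (stable_clique_crossing hS hK) => [k Kk | s Ss].
    have Yk := subsetP sKY k Kk.
    have [||s Ss ks] := maxS k.
    - by rewrite !inE (subsetP sYW) // andbT; apply: contraNneq nKv => <-.
    - by apply/negP => /(subsetP sSX)/XnY; rewrite Yk.
    - by exists s; rewrite // -[adj _ _]negbK.
  have Xs := subsetP sSX s Ss.
  apply: maxK; last by apply: contra (XnY s Xs); apply: subsetP.
  by rewrite !inE (subsetP sXW) // andbT; apply: contraNneq nSx => <-.
split=> xv; apply: contraT.
  move=> nKv; have nSx : x \notin S.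
    by apply/negP => /vS; rewrite /nonadj adj_sym xv.
  (* the crossing argument needs nonempty sets: [v] has a non-neighbour in
     [K], which in turn has a neighbour in [S] *)
  have [|k Kk vk] := maxK v _ nKv; first by rewrite !inE vx (subsetP sYW).
  have [||s Ss _] := maxS k.
  - rewrite !inE (subsetP sYW _ (subsetP sKY k Kk)) andbT.
    by apply: contraNneq nKv => <-.
  - by apply/negP => /(subsetP sSX)/XnY; rewrite (subsetP sKY).
  - by rewrite cross ?inE in Ss.
move=> nSx; have nKv : v \notin K by apply: contra xv; apply: xK.
have [|s Ss _] := maxS x _ nSx; first by rewrite !inE eq_sym vx (subsetP sXW).
by rewrite cross ?inE in Ss.
Qed.

Lemma stable_or_clique_in_bipartition X Y : [disjoint X & Y] ->
  [exists S : {set G}, (S \subset X) && maximal_in nonadj (X :|: Y) S] ||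
  [exists K : {set G}, (K \subset Y) && maximal_in (@adj G) (X :|: Y) K].
Proof.
have [n] := ubnP #|X :|: Y|; elim: n X Y => // n IHn X Y leXYn dXY.
apply: contraT; rewrite negb_or => /andP[/existsPn noS /existsPn noK].
set W := X :|: Y in leXYn noS noK.
have [sXW sYW] : X \subset W /\ Y \subset W by rewrite subsetUl subsetUr.
have XnY z : z \in X -> z \notin Y by move=> Xz; rewrite (disjointFr dXY Xz).
have YnX z : z \in Y -> z \notin X by move=> Yz; rewrite (disjointFl dXY Yz).
have leW z : z \in W -> #|W :\ z| < n.
  by move=> Wz; move: leXYn; rewrite (cardsD1 z W) Wz.
have noS' S : S \subset X -> maximal_in nonadj W S -> False.
  by move=> sS mS; move: (noS S); rewrite sS mS.
have noK' K : K \subset Y -> maximal_in (@adj G) W K -> False.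
  by move=> sK mK; move: (noK K); rewrite sK mK.
have Sof v : v \in Y -> exists S, [/\ S \subset X,
    maximal_in nonadj (W :\ v) S & forall s, s \in S -> nonadj v s].
  move=> Yv; have defW : W :\ v = X :|: (Y :\ v).
    apply/setP => z; rewrite !inE; case: eqP => //= ->.
    by rewrite (negPf (YnX v Yv)).
  have := IHn X (Y :\ v); rewrite -defW => /(_ (leW v (subsetP sYW v Yv))).
  have dXYv : [disjoint X & Y :\ v] by apply: disjointWr dXY; apply: subsetDl.
  case/(_ dXYv)/orP => /existsP[A /andP[sA mA]].
    by have [/(noS' _ sA)[]|[vA _]] := maximal_in_undelete nonadj_sym mA; exists A.
  have sAY := subset_trans sA (subsetDl Y [set v]).
  have [/(noK' _ sAY)[]|[_ ]] := maximal_in_undelete (@adj_sym G) mA.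
  by case/noK'; rewrite subUset sub1set Yv.
have Kof x : x \in X -> exists K, [/\ K \subset Y,
    maximal_in (@adj G) (W :\ x) K & forall k, k \in K -> adj x k].
  move=> Xx; have defW : W :\ x = (X :\ x) :|: Y.
    apply/setP => z; rewrite !inE; case: eqP => //= ->.
    by rewrite (negPf (XnY x Xx)).
  have := IHn (X :\ x) Y; rewrite -defW => /(_ (leW x (subsetP sXW x Xx))).
  have dXYx : [disjoint X :\ x & Y] by apply: disjointWl dXY; apply: subsetDl.
  case/(_ dXYx)/orP => /existsP[A /andP[sA mA]]; last first.
    by have [/(noK' _ sA)[]|[xA _]] := maximal_in_undelete (@adj_sym G) mA; exists A.
  have sAX := subset_trans sA (subsetDl X [set x]).
  have [/(noS' _ sAX)[]|[_ ]] := maximal_in_undelete nonadj_sym mA.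
  by case/noS'; rewrite subUset sub1set Xx.
have nonnbr_stable v x x' :
    v \in Y -> x \in X -> x' \in X -> ~~ adj x v -> ~~ adj x' v -> ~~ adj x x'.
  move=> Yv Xx Xx' nxv nx'v; have [S [sS mS vS]] := Sof v Yv.
  have inS z : z \in X -> ~~ adj z v -> z \in S.
    move=> Xz; have [K [sK mK zK]] := Kof z Xz.
    by have [_] := critical_pair dXY sXW sYW Yv Xz sS mS vS sK mK zK.
  by have /maximal_inP[/stable_nonadj hS _] := mS; apply: hS; apply: inS.
have nbr_clique x y y' : x \in X -> y \in Y -> y' \in Y ->
    adj x y -> adj x y' -> y != y' -> adj y y'.
  move=> Xx Yy Yy' xy xy'; have [K [sK mK xK]] := Kof x Xx.
  have inK z : z \in Y -> adj x z -> z \in K.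
    move=> Yz; have [S [sS mS zS]] := Sof z Yz.
    by have [] := critical_pair dXY sXW sYW Yz Xx sS mS zS sK mK xK.
  by have /maximal_inP[/homogeneousP hK _] := mK; apply: hK; apply: inK.
have X_antichain x x' : x \in X -> x' \in X -> x' != x ->
    exists2 y, y \in Y & adj x y && ~~ adj x' y.
  move=> Xx Xx' x'x; have [K [sK /maximal_inP[_ mK] xK]] := Kof x Xx.
  have [||y Ky x'y] := mK x'; last by exists y; rewrite ?(subsetP sK) ?xK.
    by rewrite in_setD1 x'x (subsetP sXW).
  by apply: contra (XnY x' Xx'); apply: subsetP.
have Y_antichain v v' : v \in Y -> v' \in Y -> v' != v ->
    exists2 x, x \in X & adj v' x.
  move=> Yv Yv' v'v; have [S [sS /maximal_inP[_ mS] vS]] := Sof v Yv.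
  have [||x Sx] := mS v'; last first.
  - by rewrite negbK => v'x; exists x; rewrite ?(subsetP sS).
  - by apply: contra (YnX v' Yv'); apply: subsetP.
  - by rewrite in_setD1 v'v (subsetP sYW).
have [hX | ] := boolP (homogeneous nonadj X).
  (* some [v] in [Y] has no neighbour in [X]; this forces [Y = [set v]], and
     then [Y] is a maximal clique *)
  case: (boolP [exists v in Y, [forall x in X, ~~ adj v x]]); last first.
    rewrite negb_exists_in => /forall_inP Ynb; case: (noS' X) => //.
    apply/maximal_inP; split=> // w /setUP[-> // | Yw] _.
    by have := Ynb w Yw; rewrite negb_forall_in => /exists_inP.
  case/exists_inP => v Yv /forall_inP vX.
  have defY y : y \in Y -> y = v.
    move=> Yy; apply/eqP; apply: contraT; rewrite eq_sym => vy.
    by have [x /vX/negPf->] := Y_antichain y v Yy Yv vy.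
  case: (noK' Y) => //; apply/maximal_inP; split.
    apply/homogeneousP => y y' /defY-> /defY->; by rewrite eqxx.
  move=> w /setUP[Xw | -> //] _; exists v; by rewrite // adj_sym vX.
rewrite negb_forall_in => /exists_inP[x Xx].
rewrite negb_forall_in => /exists_inP[x' Xx'].
rewrite negb_imply negbK => /andP[nxx' xx'].
(* [x] and [x'] have no common non-neighbour in [Y], so [Y] is covered by the
   two cliques of their neighbours, which [P_4]-freeness joins completely *)
have hY : homogeneous (@adj G) Y.
  have cov y : y \in Y -> adj x y || adj x' y.
    move=> Yy; apply: contraLR xx'; rewrite negb_or => /andP[nxy nx'y].
    exact: nonnbr_stable nxy nx'y.
  have join y y' : y \in Y -> y' \in Y -> y != y' ->
      adj x y -> adj x' y' -> adj y y'.
    move=> Yy Yy' yy' xy x'y'.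
    have [x'y|nx'y] := boolP (adj x' y); first exact: (nbr_clique x').
    have [xy'|nxy'] := boolP (adj x y'); first exact: (nbr_clique x).
    by apply: P4_free_pattern (_ : adj y x) xx' x'y' _ nxy'; rewrite // adj_sym.
  apply/homogeneousP => y y' Yy Yy' yy'.
  have [xy|x'y] := orP (cov y Yy); have [xy'|x'y'] := orP (cov y' Yy').
  - exact: (nbr_clique x).
  - exact: join.
  - by rewrite adj_sym join // eq_sym.
  - exact: (nbr_clique x').
case: (noK' Y) => //; apply/maximal_inP; split=> // w /setUP[Xw | -> //] _.
have [xw | wx] := eqVneq w x.
  have [|y Yy /andP[_ wy]] := X_antichain x' w Xx' Xw; last by exists y.
  by rewrite xw.
by have [y Yy /andP[_ wy]] := X_antichain x w Xx Xw wx; exists y.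
Qed.

(** * Minimal clique transversals *)

Lemma maximal_cliqueE K : maximal_clique K = maximal_in (@adj G) setT K.
Proof. exact/maxset_homogeneousE/adj_sym. Qed.

Lemma maximal_stable_transversal S :
  0 < #|G| -> maximal_in nonadj setT S -> clique_transversal S.
Proof.
move=> G0 mS; apply/forall_inP => K; rewrite maximal_cliqueE => mK.
have [x Sx Kx] := maximal_stable_meets_clique mS mK G0.
by apply/set0Pn; exists x; rewrite inE Sx.
Qed.

Lemma minimal_transversal_stable X :
  0 < #|G| -> minimal_clique_transversal X -> homogeneous nonadj X.
Proof.
move=> G0 /minsetP[/forall_inP trX minX].
have dX : [disjoint X & ~: X] by rewrite disjoints_subset setCK.
have := stable_or_clique_in_bipartition dX; rewrite setUCr.
case/orP => /existsP[A /andP[sA mA]].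
  by rewrite -(minX A _ sA) ?maximal_stable_transversal //; case/andP: mA.
have := trX A; rewrite maximal_cliqueE => /(_ mA)/set0Pn[x].
by rewrite inE => /andP[Xx /(subsetP sA)]; rewrite inE Xx.
Qed.

Lemma maximal_stable_minimal_transversal S :
  0 < #|G| -> maximal_in nonadj setT S -> minimal_clique_transversal S.
Proof.
move=> G0 mS; apply/minsetP; split; first exact: maximal_stable_transversal.
move=> Z /forall_inP trZ sZS; apply/eqP; rewrite eqEsubset sZS /=.
apply/subsetP => s Ss.
have cls : clique [set s].
  by apply/homogeneousP => x y /set1P-> /set1P->; rewrite eqxx.
have [K mK] := maxset_exists cls; rewrite sub1set => Ks.
have /set0Pn[z /setIP[Zz Kz]] := trZ K mK.
have [<- // | zs] := eqVneq z s.
have /homogeneousP hK := maxsetp mK; have /andP[hS _] := mS.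
by move: (stable_nonadj hS (subsetP sZS z Zz) Ss); rewrite hK.
Qed.

End P4FreeGraph.

Theorem corollary3p14 (G : sgraph) (G_nonempty : 0 < #|G|) :
  P4_free G -> CDC G.
Proof.
move=> freeG S coverS.
have hS : homogeneous (@nonadj G) S.
  apply/homogeneousP => x y Sx Sy xy.
  have [X] := coverS x y Sx Sy xy; rewrite inE => minX /andP[Xx Xy].
  have hX := minimal_transversal_stable freeG G_nonempty minX.
  exact: stable_nonadj hX Xx Xy.
have [M mM sSM] := maxset_exists hS; exists M => //.
rewrite inE; apply: maximal_stable_minimal_transversal => //.
by rewrite -maxset_homogeneousE //; apply: nonadj_sym.
Qed.
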